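(* Let $G$ be a graph of order $n$ with vertices $v_1,\dots,v_n$, vertex degrees $d_i=\deg(v_i)$ for $i=1,\dots,n$, and maximum degree $\Delta=\Delta(G)$. Then $$\rho(G)=L_1(G)\ \ge\ \sum_{i=1}^{n}\frac{1}{d_i\,\Delta+1}.$$
   Context: All graphs are finite, simple and undirected. For a vertex $v$, $N[v]$ denotes the closed neighbourhood of $v$. A vertex set $X\subseteq V(G)$ is a $1$-limited packing if $|N[v]\cap X|\le 1$ for every $v\in V(G)$ (equivalently, any two vertices of $X$ are at distance at least $3$); $L_1(G)$ is the maximum size of such a set, and the $2$-packing number is $\rho(G)=L_1(G)$. *)

(* Defs.v *)
From mathcomp Require Import all_boot all_order all_algebra.

Set Implicit Arguments.
Unset Strict Implicit.
Unset Printing Implicit Defensive.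

(* A finite simple graph is a symmetric irreflexive [e : rel T] on a finType
   [T]; these two properties are assumed in theorems, not in definitions. *)

Definition degree (T : finType) (e : rel T) (v : T) : nat :=
  #|[set u | e v u]|.

Definition max_degree (T : finType) (e : rel T) : nat :=
  \max_(v : T) degree e v.

Definition closed_nbhd (T : finType) (e : rel T) (v : T) : {set T} :=
  v |: [set u | e v u].

Definition limited_packing (T : finType) (e : rel T) (k : nat) (X : {set T})
    : bool :=
  [forall v : T, #|closed_nbhd e v :&: X| <= k].

(* The empty set is always a packing, so this is a maximum over a nonempty
   family. *)
Definition limited_packing_number (T : finType) (e : rel T) (k : nat) : nat :=
  \max_(X : {set T} | limited_packing e k X) #|X|.

Definition two_packing_number (T : finType) (e : rel T) : nat :=
  limited_packing_number e 1.

(* Main.v *)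
Require Import Defs.
From mathcomp Require Import all_boot all_order all_algebra.
Import Order.TTheory GRing.Theory Num.Theory.
Local Open Scope ring_scope.

(** Greedily pick a vertex [v] of least degree among the remaining ones and
    discard its ball of radius 2. That ball has at most [deg v * Delta + 1]
    vertices, and by the choice of [v] each discarded vertex contributes at
    most [1 / (deg v * Delta + 1)] to the sum, so every pick accounts for at
    most 1. *)

Lemma greedy_independent_set (R : numFieldType) (T : finType) (r : rel T)
    (f : T -> nat) (S : {set T}) :
  reflexive r -> symmetric r -> (forall v, #|[set u | r v u]| <= f v)%N ->
  exists I : {set T}, [/\ I \subset S,
    {in I &, forall x y, r x y -> x = y} &
    \sum_(v in S) (f v)%:R^-1 <= #|I|%:R :> R].
Proof.
move=> r_refl r_sym ball_le.
(* Only the set [S] of remaining vertices shrinks. Balls and [f] refer to all of [T], so [ball_le]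
   serves unchanged at every stage. *)
have [n] := ubnP #|S|; elim: n S => // n IHn S ltSn.
have [->|[v0 v0S]] := set_0Vmem S.
  by exists set0; split; rewrite ?sub0set ?big_set0 ?cards0 // => x y; rewrite inE.
case: (@arg_minnP _ v0 (fun u => u \in S) f v0S) => v vS v_min.
pose B := [set u | r v u].
have vB : v \in B by rewrite inE.
have ltDS : (#|S :\: B| < #|S|)%N.
  apply/proper_card/properP; split; first exact: subsetDl.
  by exists v => //; rewrite in_setD vB.
have [I [IsD Iind leI]] := IHn _ (leq_trans ltDS (ltnSE ltSn)).
have nrv x : x \in I -> ~~ r v x.
  by move=> /(subsetP IsD); rewrite !inE => /andP[].
have vNI : v \notin I by apply/negP => /nrv; rewrite r_refl.
exists (v |: I); split.
- by rewrite subUset sub1set vS (subset_trans IsD) ?subsetDl.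
- move=> x y /setU1P[->|xI] /setU1P[->|yI] //.
  + by rewrite (negPf (nrv _ yI)).
  + by rewrite r_sym (negPf (nrv _ xI)).
  + exact: Iind.
rewrite (big_setID B) /= cardsU1 vNI natrD lerD //.
(* As [0^-1] is [0], inverting [f v <= f u] requires positive values. Reflexivity puts [v] in its
   own ball, and minimality passes positivity on to each [f u]. *)
have fv_gt0 : (0 < f v)%N.
  by apply: leq_trans (ball_le v); apply/card_gt0P; exists v.
have leB : \sum_(u in S :&: B) (f u)%:R^-1 <= \sum_(u in S :&: B) (f v)%:R^-1 :> R.
  apply: ler_sum => u /setIP[uS _].
  have le_vu := v_min u uS.
  by rewrite lef_pV2 ?ler_nat // posrE ltr0n ?(leq_trans fv_gt0).
apply: le_trans leB _.
rewrite sumr_const -(mulr_natl _ #|_|) ler_pdivrMr ?ltr0n // mul1r ler_nat.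
exact: leq_trans (subset_leq_card (subsetIr _ _)) (ball_le v).
Qed.

(** For symmetric [e] this is distance at most 2. A shared closed neighbourhood treats equality,
    adjacency and a common neighbour uniformly, and is the very configuration that a 1-limited
    packing forbids for distinct vertices. *)
Definition within_two (T : finType) (e : rel T) : rel T := fun x y =>
  [exists w, (x \in closed_nbhd e w) && (y \in closed_nbhd e w)].

Lemma within_two_refl (T : finType) (e : rel T) : reflexive (within_two T e).
Proof. by move=> x; apply/existsP; exists x; rewrite !inE eqxx. Qed.

Lemma within_two_sym (T : finType) (e : rel T) : symmetric (within_two T e).
Proof. by move=> x y; apply: eq_existsb => w; rewrite andbC. Qed.

Lemma card_within_two (T : finType) (e : rel T) (x : T) : symmetric e ->
  (#|[set y | within_two T e x y]| <= degree e x * max_degree e + 1)%N.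
Proof.
move=> e_sym.
pose N := [set w | e x w].
(* As [w] is adjacent to [x], removing [x] from [closed_nbhd e w] compensates
   for [w] itself: each set of the union has at most [degree e w] vertices. *)
have sub : [set y | within_two T e x y]
    \subset x |: \bigcup_(w in N) (closed_nbhd e w :\ x).
  apply/subsetP => y; rewrite !inE => /existsP[w].
  have [//|yx] := eqVneq y x.
  (* The witness [w] may be [x] itself, which is no index of the union; [y] is then a neighbour of
     [x] and is covered by its own closed neighbourhood. *)
  rewrite !inE => /andP[/predU1P[<-|ewx] /predU1P[yw|ewy]] /=.
  - by rewrite yw eqxx in yx.
  - by apply/bigcupP; exists y; rewrite !inE ?yx ?eqxx.
  - by apply/bigcupP; exists w; rewrite !inE ?yx ?yw ?eqxx // e_sym.
  - by apply/bigcupP; exists w; rewrite !inE ?yx ?ewy ?orbT // e_sym.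
apply: leq_trans (subset_leq_card sub) _.
rewrite cardsU1 addnC; apply: leq_add; last exact: leq_b1.
rewrite /degree -/N -sum_nat_const.
have card_bigcup : (#|\bigcup_(w in N) (closed_nbhd e w :\ x)|
    <= \sum_(w in N) #|closed_nbhd e w :\ x|)%N.
  elim/big_rec2: _ => [|w m A _ leA]; first by rewrite cards0.
  by rewrite (leq_trans (leq_card_setU _ _)) ?leq_add2l.
apply: leq_trans card_bigcup _; apply: leq_sum => w; rewrite inE => exw.
have le_max : (degree e w <= max_degree e)%N by apply: leq_bigmax.
apply: leq_trans _ le_max.
have := cardsD1 x (closed_nbhd e w); rewrite !inE e_sym exw orbT add1n.
rewrite /closed_nbhd cardsU1 => card_eq.
by rewrite -ltnS -card_eq -add1n leq_add2r leq_b1.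
Qed.

Lemma independent_within_two_packing (T : finType) (e : rel T) (X : {set T}) :
  {in X &, forall x y, within_two T e x y -> x = y} -> limited_packing e 1 X.
Proof.
move=> Xind; apply/forallP => w; apply/card_le1_eqP => x y.
move=> /setIP[xw xX] /setIP[yw yX].
by apply: Xind => //; apply/existsP; exists w; rewrite xw yw.
Qed.

Theorem theorem3 (T : finType) (e : rel T)
    (e_sym : symmetric e) (e_irr : irreflexive e) :
  two_packing_number e = limited_packing_number e 1 /\
  \sum_(v : T) 1 / ((degree e v)%:R * (max_degree e)%:R + 1)
    <= (limited_packing_number e 1)%:R :> rat.
Proof.
split=> //.
(* The greedy choice starts from all vertices; [card_within_two] fixes [f v] as
   [degree e v * max_degree e + 1], the denominator in the sum. *)
have [I [_ /independent_within_two_packing I_pack leI]] :=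
  greedy_independent_set rat T _ _ setT (within_two_refl T e)
    (within_two_sym T e) (fun v => card_within_two T e v e_sym).
have le_card : #|I|%:R <= (limited_packing_number e 1)%:R :> rat.
  by rewrite ler_nat /limited_packing_number (bigD1 I) //= leq_maxl.
apply: le_trans le_card; apply: le_trans leI.
rewrite [leRHS](eq_bigl predT) => [|v]; last exact: in_setT.
by apply: ler_sum => v _; rewrite div1r natrD natrM.
Qed.
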